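(* Let $\{\Lambda_i\}_{i\in\mathbb{N}}$ be a countable system of arbitrary closed cones in $\mathbb{R}^n$ satisfying the normal qualification condition at the origin. Then for any Fréchet normal $x^*\in\widehat N\big(0;\bigcap_{i=1}^\infty\Lambda_i\big)$ satisfying $$\langle x^*,x\rangle<0\quad\text{whenever}\quad x\in\bigcap_{i=1}^\infty\Lambda_i\setminus\{0\}$$ there are limiting normals $x_i^*\in N(0;\Lambda_i)$, $i=1,2,\ldots$, such that $$x^*=\sum_{i=1}^\infty\frac{1}{2^i}x_i^*.$$
   Context: $\mathbb{R}^n$ carries the Euclidean norm $\|\cdot\|$ and is identified with its dual; $\mathbb{N}=\{1,2,\ldots\}$. A cone is a set $\Lambda$ with $0\in\Lambda$ and $\lambda v\in\Lambda$ whenever $v\in\Lambda$, $\lambda\ge 0$; cones need not be convex. Infinite sums are sums of convergent series. For $\Omega\subset\mathbb{R}^n$, $\bar x\in\Omega$, $\varepsilon\ge 0$, the set of $\varepsilon$-normals is $$\widehat N_\varepsilon(\bar x;\Omega)=\Big\{x^*\Big|\ \limsup_{x\to\bar x,\,x\in\Omega,\,x\neq\bar x}\frac{\langle x^*,x-\bar x\rangle}{\|x-\bar x\|}\le\varepsilon\Big\}$$ (the condition being vacuous if $\bar x$ is isolated in $\Omega$), and $\widehat N(\bar x;\Omega):=\widehat N_0(\bar x;\Omega)$ is the Fréchet normal cone. The limiting normal cone $N(\bar x;\Omega)$ is the set of all $x^*$ for which there are sequences $\varepsilon_k\downarrow 0$, $x_k\to\bar x$ with $x_k\in\Omega$, and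 $x_k^*\to x^*$ with $x_k^*\in\widehat N_{\varepsilon_k}(x_k;\Omega)$ for all $k$. Normal qualification condition at the origin for $\{\Lambda_i\}_{i\in\mathbb{N}}$: whenever $x_i^*\in N(0;\Lambda_i)$ for all $i\in\mathbb{N}$ and $\sum_{i=1}^\infty x_i^*=0$, one has $x_i^*=0$ for all $i\in\mathbb{N}$. *)

(* Defs.v *)
From HB Require Import structures.
From mathcomp Require Import all_boot all_order all_algebra.
From mathcomp Require Import all_classical all_reals all_analysis.

Set Implicit Arguments.
Unset Strict Implicit.
Unset Printing Implicit Defensive.

Import Order.TTheory GRing.Theory Num.Theory.
Import numFieldNormedType.Exports.

Local Open Scope classical_set_scope.
Local Open Scope ring_scope.

Definition dotv (R : realType) (n : nat) (u v : 'rV[R]_n) : R :=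
  \sum_(i < n) u 0 i * v 0 i.

(* The library norm on ['rV[R]_n] is the sup norm, so the Euclidean norm is
   defined separately. Both induce the library topology of ['rV[R]_n], which is
   the one used for neighbourhoods, limits and closed sets below. *)
Definition enorm (R : realType) (n : nat) (u : 'rV[R]_n) : R :=
  Num.sqrt (dotv u u).

(* Not necessarily convex. *)
Definition is_cone (R : realType) (n : nat) (L : set 'rV[R]_n) : Prop :=
  L 0 /\ (forall (v : 'rV[R]_n) (l : R), L v -> 0 <= l -> L (l *: v)).

(* Meaningful for [xbar] in [Omega]. The upper limit is extended-real: when
   [xbar] is isolated in [Omega] the filter contains the empty set, the upper
   limit is [-oo] and the condition is vacuous. *)
Definition eps_normals (R : realType) (n : nat) (eps : R) (xbar : 'rV[R]_n)
    (Omega : set 'rV[R]_n) : set 'rV[R]_n :=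
  [set xs : 'rV[R]_n | (limf_esup
     (fun x : 'rV[R]_n => (dotv xs (x - xbar) / enorm (x - xbar))%:E)
     (within Omega xbar^') <= eps%:E)%E].

Definition frechet_normals (R : realType) (n : nat) (xbar : 'rV[R]_n)
    (Omega : set 'rV[R]_n) : set 'rV[R]_n :=
  eps_normals 0 xbar Omega.

(* [eps_k] decreasing to 0 is read as [eps_k >= 0] and [eps_k --> 0]; as
   [eps_normals] is monotone in [eps], requiring [eps_k > 0] or monotonicity of
   the sequence in addition gives the same set. *)
Definition limiting_normals (R : realType) (n : nat) (xbar : 'rV[R]_n)
    (Omega : set 'rV[R]_n) : set 'rV[R]_n :=
  [set xs : 'rV[R]_n | exists (eps : nat -> R) (x y : nat -> 'rV[R]_n),
     [/\ (forall k, 0 <= eps k) /\ eps @ \oo --> (0 : R),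
         (forall k, Omega (x k)) /\ x @ \oo --> xbar,
         y @ \oo --> xs &
         forall k, eps_normals (eps k) (x k) Omega (y k)]].

(* Countable families are indexed by [nat], starting at 0: [L i] stands for the
   (i+1)-st cone. *)
Definition normal_qualification (R : realType) (n : nat)
    (L : nat -> set 'rV[R]_n) : Prop :=
  forall xs : nat -> 'rV[R]_n,
    (forall i, limiting_normals 0 (L i) (xs i)) ->
    series xs @ \oo --> (0 : 'rV[R]_n) ->
    forall i, xs i = 0.

(* Main.v *)
Require Import Defs.
From HB Require Import structures.
From mathcomp Require Import all_boot all_order all_algebra.
From mathcomp Require Import all_classical all_reals all_analysis.
From mathcomp Require Import ring lra.

Set Implicit Arguments.
Unset Strict Implicit.
Unset Printing Implicit Defensive.

Import Order.TTheory GRing.Theory Num.Theory.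
Import numFieldNormedType.Exports.

Local Open Scope classical_set_scope.
Local Open Scope ring_scope.

(** By compactness of the unit sphere, finitely many cones [L i], [i < N],
    already force [dotv xstar x < 0] on the nonzero points of their
    intersection. Let [d_i] be the Euclidean distance to [L i]. For [K] large,
    [K * \sum_(i < N) d_i^2 - dotv xstar] is positive on the sphere, hence has
    a global minimizer [z]. Replacing [d_i] by the distance to a fixed nearest
    point [p_i] of [z] in [L i] keeps [z] a minimizer and makes the function
    smooth; stationarity reads [xstar = \sum_(i < N) 2 K (z - p_i)]. Each
    [z - p_i] is a proximal normal to [L i] at [p_i], hence, as [L i] is a
    cone, a limiting normal at the origin; the weights [1 / 2^(i+1)] are
    absorbed by rescaling it. *)

(** * Inner product and its comparison with the sup norm *)

Lemma dotvC (R : realType) n (u v : 'rV[R]_n) : dotv u v = dotv v u.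
Proof. by apply: eq_bigr => i _; rewrite mulrC. Qed.

Lemma dotvDl (R : realType) n (u v w : 'rV[R]_n) :
  dotv (u + v) w = dotv u w + dotv v w.
Proof. by rewrite -big_split; apply: eq_bigr => i _; rewrite !mxE mulrDl. Qed.

Lemma dotvZl (R : realType) n (a : R) (u w : 'rV[R]_n) :
  dotv (a *: u) w = a * dotv u w.
Proof. by rewrite mulr_sumr; apply: eq_bigr => i _; rewrite !mxE mulrA. Qed.

Lemma dotvNl (R : realType) n (u w : 'rV[R]_n) : dotv (- u) w = - dotv u w.
Proof. by rewrite -scaleN1r dotvZl mulN1r. Qed.

Lemma dotvDr (R : realType) n (u v w : 'rV[R]_n) :
  dotv u (v + w) = dotv u v + dotv u w.
Proof. by rewrite !(dotvC u) dotvDl. Qed.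

Lemma dotvZr (R : realType) n (a : R) (u w : 'rV[R]_n) :
  dotv u (a *: w) = a * dotv u w.
Proof. by rewrite !(dotvC u) dotvZl. Qed.

Lemma dotvNr (R : realType) n (u w : 'rV[R]_n) : dotv u (- w) = - dotv u w.
Proof. by rewrite !(dotvC u) dotvNl. Qed.

Lemma dotv_suml (R : realType) n (I : Type) (r : seq I) (f : I -> 'rV[R]_n) w :
  dotv (\sum_(i <- r) f i) w = \sum_(i <- r) dotv (f i) w.
Proof.
elim/big_ind2: _ => [|a b c d <- <-|//]; last by rewrite dotvDl.
by rewrite -(scale0r 0) dotvZl mul0r.
Qed.

Definition dotvE := (dotvDl, dotvDr, dotvZl, dotvZr, dotvNl, dotvNr).

Lemma dotv_ge0 (R : realType) n (u : 'rV[R]_n) : 0 <= dotv u u.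
Proof. by apply: sumr_ge0 => i _; rewrite -expr2 sqr_ge0. Qed.

Lemma coord_le_norm (R : realType) n (u : 'rV[R]_n) i : `|u 0 i| <= `|u|.
Proof.
rewrite [in leRHS]/Num.Def.normr /= mx_normrE.
exact: (le_bigmax _ (fun ij => `|u ij.1 ij.2|) (0, i)).
Qed.

(** The norm here is the sup norm, so each of the [n] products is at most [|u| * |v|]. This crude
    form of Cauchy-Schwarz suffices, as only finiteness of the constant matters. *)
Lemma norm_dotv_le (R : realType) n (u v : 'rV[R]_n) :
  `|dotv u v| <= n%:R * (`|u| * `|v|).
Proof.
apply: (le_trans (ler_norm_sum _ _ _)).
apply: (@le_trans _ _ (\sum_(i < n) `|u| * `|v|)).
  by apply: ler_sum => i _; rewrite normrM ler_pM ?coord_le_norm.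
by rewrite sumr_const card_ord mulr_natl.
Qed.

Lemma sqr_norm_le_dotv (R : realType) n (u : 'rV[R]_n) : `|u| ^+ 2 <= dotv u u.
Proof.
have [->|u0] := eqVneq `|u| 0; first by rewrite expr0n dotv_ge0.
have [[i j] /=] := mx_norm_neq0 u0; rewrite ord1 => uj.
rewrite [X in X ^+ 2]uj real_normK ?num_real// /dotv (bigD1 j)//= -expr2 lerDl.
by apply: sumr_ge0 => k _; rewrite -expr2 sqr_ge0.
Qed.

Lemma dotv_eq0 (R : realType) n (u : 'rV[R]_n) : dotv u u <= 0 -> u = 0.
Proof.
move=> u0; apply/normr0_eq0/eqP; rewrite -sqrf_eq0 eq_le sqr_ge0 andbT.
exact: le_trans (sqr_norm_le_dotv u) u0.
Qed.

Lemma cvg_dotv (R : realType) n (T : Type) (F : set_system T) {FF : Filter F}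
    (f g : T -> 'rV[R]_n) (a b : 'rV[R]_n) :
  f @ F --> a -> g @ F --> b -> (fun x => dotv (f x) (g x)) @ F --> dotv a b.
Proof.
move=> fa gb; rewrite /dotv.
apply: cvg_big => [x|i _]; first exact: add_continuous.
have coordC (h : T -> 'rV[R]_n) (c : 'rV[R]_n) :
    h @ F --> c -> h x 0 i @[x --> F] --> c 0 i.
  by move=> hc; apply: (cvg_comp h (fun M : 'rV[R]_n => M 0 i) hc);
    exact: coord_continuous.
by apply: cvgM; exact: coordC.
Qed.

Lemma continuous_sqdist (R : realType) n (u : 'rV[R]_n) :
  continuous (fun x : 'rV[R]_n => dotv (x - u) (x - u)).
Proof.
move=> x; apply: (@cvg_dotv _ _ _ (nbhs x));
  exact: (@cvgB _ _ _ (nbhs x) _ id (cst u) x u cvg_id (cvg_cst u)).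
Qed.

Lemma continuous_dotv (R : realType) n (u : 'rV[R]_n) : continuous (dotv u).
Proof.
move=> x.
exact: (@cvg_dotv _ _ _ (nbhs x) _ (cst u) id u x (cvg_cst u) cvg_id). Qed.

(** * Nearest points and continuity of the squared distance *)

(** A relation rather than a projection map: in a nonconvex set nearest points need not be
    unique. *)
Definition nearest (R : realType) n (L : set 'rV[R]_n) (x u : 'rV[R]_n) : Prop :=
  L u /\ forall v, L v -> dotv (x - u) (x - u) <= dotv (x - v) (x - v).

(** Only points of [L] at least as close to [x] as [0] can compete, and these form a compact set. *)
Lemma exists_nearest (R : realType) n (L : set 'rV[R]_n) x :
  closed L -> L 0 -> exists u, nearest L x u.
Proof.
move=> Lcl L0; pose f v := dotv (v - x) (v - x).
have fE v : dotv (x - v) (x - v) = f v.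
  by rewrite -opprB /f dotvNl dotvNr opprK.
pose A := L `&` [set v | f v <= f 0].
have Acl : closed A.
  apply: closedI => //; apply: (@preimage_closed _ _ f [set t | t <= f 0]).
    by move=> v _; exact: continuous_sqdist.
  exact: closed_le.
have Abd : bounded_set A.
  (* From [|v - x| ^+ 2 <= f 0] follows [|v - x| <= 1 + f 0], without square roots. *)
  exists (`|x| + (1 + f 0)); split; first exact: num_real.
  move=> M ltM v [Lv /= fv]; apply: le_trans (ltW ltM).
  rewrite -[v](subrK x) addrC (le_trans (ler_normD _ _))// lerD2l.
  have := le_trans (sqr_norm_le_dotv (v - x)) fv.
  have := dotv_ge0 (0 - x); rewrite -/(f 0); nra.
have A0 : A 0 by split => /=.
have [|u /[!inE] -[Lu fu] umin] :=
    @EVT_min_rV _ _ f A (ex_intro _ 0 A0) (bounded_closed_compact Abd Acl).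
  by apply: continuous_subspaceT; exact: continuous_sqdist.
exists u; split=> // v Lv; rewrite !fE.
have [fv|/ltW] := leP (f v) (f 0); last exact: le_trans.
by apply: umin; rewrite inE.
Qed.

(** The selection [p] may jump, but [q] does not: using [p x] as a competitor for [y], and
    conversely, bounds the change of [q] from both sides. *)
Lemma continuous_sqdist_nearest (R : realType) n (L : set 'rV[R]_n)
    (p : 'rV[R]_n -> 'rV[R]_n) :
  L 0 -> (forall x, nearest L x (p x)) ->
  continuous (fun x : 'rV[R]_n => dotv (x - p x) (x - p x)).
Proof.
move=> L0 pP; set q := (fun x => dotv _ _).
have pN x : `|x - p x| <= n.+1%:R * `|x|.
  rewrite -ler_sqr ?nnegrE ?mulr_ge0//.
  apply: le_trans (sqr_norm_le_dotv _) _.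
  have := (pP x).2 0 L0; rewrite subr0 => /le_trans; apply.
  have := norm_dotv_le x x; rewrite ger0_norm ?dotv_ge0// => /le_trans; apply.
  rewrite -expr2 exprMn ler_wpM2r ?sqr_ge0// -natrX ler_nat.
  by rewrite (leq_trans (leqnSn n))// leq_pmulr.
(* With [a = y - x] and [b = x - p x], [q y - q x] is at most [<a,a> + 2 <a,b>]. The summand [1] of
   [M] pays for [<a,a>], and [2 * n.+1] for the cross terms through [pN]. *)
pose M : R := n%:R * (2 * n.+1%:R + 1).
have qle x y : q y <= q x + M * (`|y - x| * (`|x| + `|y|)).
  apply: le_trans ((pP y).2 (p x) (pP x).1) _.
  have -> : y - p x = (y - x) + (x - p x) by rewrite addrA subrK.
  have sqD (a b : 'rV[R]_n) :
      dotv (a + b) (a + b) = dotv b b + (dotv a a + dotv a b + dotv a b).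
    by rewrite !dotvE (dotvC b a); ring.
  rewrite sqD lerD2l.
  have := norm_dotv_le (y - x) (y - x); have := norm_dotv_le (y - x) (x - p x).
  move=> /(le_trans (ler_norm _)) h1 /(le_trans (ler_norm _)) h2.
  apply: le_trans (lerD (lerD h2 h1) h1) _.
  rewrite /M -!mulrDr -mulrA ler_wpM2l// mulrCA ler_wpM2l//.
  have := ler_normB y x; have := pN x.
  have : 0 <= n.+1%:R * `|y| by rewrite mulr_ge0.
  have := normr_ge0 x; have := normr_ge0 y; nra.
suff qc (y : 'rV[R]_n) : q x @[x --> y] --> q y by move=> y; exact: qc.
have hM (F : set_system 'rV[R]_n) (FF : Filter F) : id @ F --> y ->
    M * (`|y - x| * (`|x| + `|y|)) @[x --> F] --> (0 : R).
  move=> Fy.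
  have -> : 0 = M * (`|y - y| * (`|y| + `|y|)) by rewrite subrr normr0 mul0r mulr0.
  apply: cvgM; first exact: cvg_cst.
  apply: cvgM; first by apply: cvg_norm; apply: cvgB => //; exact: cvg_cst.
  by apply: cvgD; [exact: cvg_norm|exact: cvg_cst].
have {}hM := hM (nbhs y) (nbhs_filter y) cvg_id.
apply: (@squeeze_cvgr _ (nbhs y) _ _ (fun x => q y - M * (`|y - x| * (`|x| + `|y|)))
  (fun x => q y + M * (`|y - x| * (`|x| + `|y|)))).
- near=> x; rewrite lerBlDr qle /= (le_trans (qle y x))//.
  by rewrite distrC (addrC `|y|).
- rewrite -[X in _ --> X]subr0.
  exact: (@cvgB _ _ _ (nbhs y) _ (cst (q y)) _ _ _ (cvg_cst _) hM).
- rewrite -[X in _ --> X]addr0.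
  exact: (@cvgD _ _ _ (nbhs y) _ (cst (q y)) _ _ _ (cvg_cst _) hM).
Unshelve. all: by end_near. Qed.

(** * From proximal to limiting normals *)

Lemma cvg_enorm (R : realType) n (u : 'rV[R]_n) :
  enorm (x - u) @[x --> u] --> (0 : R).
Proof.
have d0 : dotv (u - u) (u - u) = 0 by rewrite subrr -(scale0r 0) dotvZl mul0r.
have := cvg_comp (fun x : 'rV[R]_n => dotv (x - u) (x - u)) Num.sqrt
  (@continuous_sqdist _ _ u u) (@sqrt_continuous _ _).
by rewrite /= d0 sqrtr0.
Qed.

(** Dividing the quadratic bound by [enorm (x - u)] leaves [M * enorm (x - u)], which tends to 0. *)
Lemma proximal_frechet_normals (R : realType) n (L : set 'rV[R]_n)
    (u y : 'rV[R]_n) (M : R) : 0 <= M ->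
  (forall x, L x -> dotv y (x - u) <= M * dotv (x - u) (x - u)) ->
  frechet_normals u L y.
Proof.
move=> M0 yP; apply/lee_addgt0Pr => e e0; rewrite add0e.
apply: ge_ereal_inf.
(* The upper limit is an infimum of suprema over sets of the filter; [V] is one whose supremum is at
   most [e]. *)
pose V := [set x | [/\ L x, x != u & M * enorm (x - u) <= e]].
exists (ereal_sup [set (dotv y (x - u) / enorm (x - u))%:E | x in V]).
  exists V => //.
  have : M * enorm (x - u) @[x --> u] --> (0 : R).
    rewrite -[X in _ --> X](mulr0 M).
    exact: (@cvgM _ _ (nbhs u) _ (cst M) _ _ _ (cvg_cst M) (@cvg_enorm _ _ u)).
  move=> /cvgrPdist_le /(_ e e0) near_e.
  rewrite /within /=; near=> x => Lx; split=> //.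
    by near: x; exact: nbhs_dnbhs_neq.
  have : `|0 - M * enorm (x - u)| <= e by near: x; exact: (@nbhs_dnbhs _ u _ near_e).
  by rewrite sub0r normrN => /(le_trans (ler_norm _)).
apply: ge_ereal_sup => _ [x [Lx xu xe] <-]; rewrite lee_fin.
apply: le_trans xe.
have d0 : 0 < dotv (x - u) (x - u).
  rewrite lt_neqAle dotv_ge0 andbT eq_sym; apply: contra_neq xu => d0.
  by apply/eqP; rewrite -subr_eq0; apply/eqP/dotv_eq0; rewrite d0.
rewrite ler_pdivrMr ?sqrtr_gt0// -mulrA -expr2 sqr_sqrtr ?dotv_ge0//.
exact: yP.
Unshelve. all: by end_near. Qed.

(** The constant vector [c *: (z - u)] is a Fréchet normal at every point [t *: u], [t > 0], of the
    ray through [u], and these points tend to the origin. *)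
Lemma nearest_limiting_normals (R : realType) n (L : set 'rV[R]_n)
    (z u : 'rV[R]_n) (c : R) :
  is_cone L -> nearest L z u -> 0 <= c -> limiting_normals 0 L (c *: (z - u)).
Proof.
move=> [L0 LZ] [Lu umin] c0.
exists (fun=> 0), (fun k => harmonic k *: u), (fun=> c *: (z - u)); split.
- by split=> //; exact: cvg_cst.
- split=> [k|]; first by apply: LZ => //=; rewrite invr_ge0.
  by rewrite -[X in _ --> X](scale0r u); apply: cvgZr_tmp; exact: cvg_harmonic.
- exact: cvg_cst.
move=> k; set t : R := harmonic k.
have t0 : 0 < t by rewrite invr_gt0.
(* Let [a = z - u] and [b = x - t *: u]. The point [t^-1 *: x] of the cone is no closer to [z] than
   [u], so [2 <a,b> <= t^-1 <b,b>]; hence the constant. *)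
apply: (@proximal_frechet_normals _ _ _ _ _ (c * (t^-1 / 2))) => [|x Lx].
  by rewrite mulr_ge0// divr_ge0// invr_ge0 ltW.
have := umin _ (LZ _ t^-1 Lx _); rewrite invr_ge0 ltW// => /(_ isT).
have -> : z - t^-1 *: x = (z - u) - t^-1 *: (x - t *: u).
  rewrite scalerBr scalerA mulVf ?gt_eqF// scale1r opprB addrA.
  by rewrite subrK.
move: (z - u) (x - t *: u) => a b.
rewrite !dotvE (dotvC b a) => h; rewrite -mulrA ler_wpM2l//.
have ti : 0 < t^-1 by rewrite invr_gt0.
rewrite -(ler_pM2l ti); nra.
Qed.

(** * Compactness: finitely many cones and a penalized minimizer *)

Lemma sphere_compact (R : realType) n (B : set 'rV[R]_n) :
  closed B -> compact ([set x : 'rV[R]_n | `|x| = 1] `&` B).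
Proof.
move=> Bcl; apply: bounded_closed_compact.
  exists 1; split; first exact: num_real.
  by move=> M M1 x [/= -> _]; exact: ltW.
apply: closedI => //; apply: (@preimage_closed _ _ (fun x : 'rV[R]_n => `|x|)
  [set t : R | t = 1]).
  by move=> x _; exact: norm_continuous.
exact: closed_eq.
Qed.

(** Finite intersection property: if every [N] failed, the compact part of the sphere where
    [0 <= dotv xs x] would contain a point of all the [L i]. *)
Lemma finite_bigcap_lt0 (R : realType) n (L : nat -> set 'rV[R]_n) xs :
  (forall i, closed (L i)) ->
  (forall x, (\bigcap_i L i) x -> x != 0 -> dotv xs x < 0) ->
  exists N : nat, forall x, `|x| = 1 -> (forall i, (i < N)%N -> L i x) ->
    dotv xs x < 0.
Proof.
move=> Lcl xsL; apply: contrapT => /forallNP noN.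
pose B := [set x | 0 <= dotv xs x].
have Bcl : closed B.
  apply: (@preimage_closed _ _ (dotv xs) [set t | 0 <= t]).
    by move=> x _; exact: continuous_dotv.
  exact: closed_ge.
have := sphere_compact Bcl; set S := _ `&` _; rewrite compact_In0.
move=> /(_ nat setT (fun i => S `&` L i)) [].
- by exists L.
(* The bound on indices is strict, so maximum plus one covers all of [D]. *)
- move=> D _; have /existsNP[x] := noN (\max_(i <- finmap.enum_fset D) i).+1.
  move=> /not_implyP[x1] /not_implyP[Lx] /negP; rewrite -leNgt => xx.
  exists x => i /= iD; split; first by split.
  by apply: Lx; rewrite ltnS; exact: leq_bigmax_seq.
move=> x Sx; have [[/= x1 xx] _] := Sx 0%N I.
have : dotv xs x < 0.
  apply: xsL => [i _|]; first by have [] := Sx i I.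
  by rewrite -normr_eq0 x1 oner_eq0.
by rewrite ltNge xx.
Qed.

(* [D] is a sum of squared distances to cones, so along a ray it grows
   quadratically while [dotv xs] is linear: positivity of the penalized
   function on the sphere propagates outside the unit ball. *)
Lemma penalized_min (R : realType) n (L : nat -> set 'rV[R]_n)
    (p : nat -> 'rV[R]_n -> 'rV[R]_n) (N : nat) (xs : 'rV[R]_n) :
  (forall i, is_cone (L i)) -> (forall i x, nearest (L i) x (p i x)) ->
  (forall x, `|x| = 1 -> (forall i, (i < N)%N -> L i x) -> dotv xs x < 0) ->
  exists2 K : R, 0 <= K & exists z, forall x,
    K * \sum_(i < N) dotv (z - p i z) (z - p i z) - dotv xs z <=
    K * \sum_(i < N) dotv (x - p i x) (x - p i x) - dotv xs x.
Proof.
move=> Lcone pP xsN.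
pose D x : R := \sum_(i < N) dotv (x - p i x) (x - p i x).
have D0 x : 0 <= D x by apply: sumr_ge0 => i _; exact: dotv_ge0.
have Dcont : continuous D.
  have h (x : 'rV[R]_n) : D y @[y --> x] --> D x.
    apply: (@cvg_big _ _ _ _ _ _ _ (nbhs x)) => [y|i _]; first exact: add_continuous.
    exact: (continuous_sqdist_nearest (Lcone i).1 (pP i)).
  by move=> x; exact: h.
pose phi K x : R := K * D x - dotv xs x.
have phicont K : continuous (phi K).
  have h (x : 'rV[R]_n) : phi K y @[y --> x] --> phi K x.
    apply: (@cvgB _ _ _ (nbhs x) _ (fun y => K * D y) (dotv xs)); last first.
      exact: continuous_dotv.
    apply: (@cvgM _ _ (nbhs x) _ (cst K) D); first exact: cvg_cst.
    exact: Dcont.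
  by move=> x; exact: h.
(* Scaling the nearest point of [t *: x] back by [t^-1] stays in the cone and competes for [x]. *)
have DZ (t : R) x : 1 <= t -> t ^+ 2 * D x <= D (t *: x).
  move=> t1; have t0 : 0 < t by lra.
  rewrite mulr_sumr; apply: ler_sum => i _.
  have [Lu _] := pP i (t *: x).
  have := (pP i x).2 _ ((Lcone i).2 _ t^-1 Lu _); rewrite invr_ge0 ltW// => /(_ isT).
  move=> /(ler_wpM2l (sqr_ge0 t)) /le_trans; apply.
  have -> : t *: x - p i (t *: x) = t *: (x - t^-1 *: p i (t *: x)).
    by rewrite scalerBr scalerA divff ?gt_eqF// scale1r.
  by rewrite dotvZl dotvZr mulrA -expr2.
(* Only sphere points with [0 <= dotv xs x] matter. If there are any, [D] has a positive minimum
   [D c] there, and [K * D c] is made equal to [n%:R * |xs| + 1], which exceeds [dotv xs] on the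
   sphere. *)
have [K K0 phi_gt0] : exists2 K : R, 0 <= K & forall x, `|x| = 1 -> 0 < phi K x.
  pose B := [set x | 0 <= dotv xs x].
  have Bcl : closed B.
    apply: (@preimage_closed _ _ (dotv xs) [set t | 0 <= t]).
      by move=> x _; exact: continuous_dotv.
    exact: closed_ge.
  have Scpt := sphere_compact Bcl.
  have [[a Sa]|S0] := pselect ([set x : 'rV[R]_n | `|x| = 1] `&` B !=set0); last first.
    exists 0 => // x x1; rewrite /phi mul0r sub0r oppr_gt0 ltNge.
    by apply/negP => xx; apply: S0; exists x.
  have [|c /[!inE] -[/= c1 cc] cmin] :=
    @EVT_min_rV _ _ D _ (ex_intro _ a Sa) Scpt.
    exact: continuous_subspaceT.
  (* [D c = 0] would put [c] in every [L i] with [i < N], against the sign of [dotv xs c]. *)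
  have Dc : 0 < D c.
    rewrite lt_neqAle D0 andbT eq_sym; apply/negP => /eqP Dc.
    have := xsN c c1; rewrite ltNge cc; suff Lc : forall i, (i < N)%N -> L i c.
      by move=> /(_ Lc).
    move=> i iN; have -> : c = p i c; last exact: (pP i c).1.
    apply/eqP; rewrite -subr_eq0; apply/eqP/dotv_eq0; rewrite -Dc /D.
    rewrite (bigD1 (Ordinal iN))//= lerDl.
    by apply: sumr_ge0 => j _; exact: dotv_ge0.
  have C0 : 0 <= n%:R * `|xs| + 1 by rewrite addr_ge0// mulr_ge0.
  have K0 : 0 <= (n%:R * `|xs| + 1) / D c by rewrite divr_ge0.
  exists ((n%:R * `|xs| + 1) / D c) => // x x1.
  have [xx|xx] := leP 0 (dotv xs x); last first.
    by rewrite subr_gt0 (lt_le_trans xx)// mulr_ge0.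
  have Dx : D c <= D x by apply: cmin; rewrite inE.
  rewrite subr_gt0.
  apply: (@lt_le_trans _ _ (n%:R * `|xs| + 1)).
    have := norm_dotv_le xs x; rewrite x1 mulr1 => /(le_trans (ler_norm _)).
    by move=> /le_lt_trans; apply; rewrite ltrDl.
  by rewrite mulrAC ler_pdivlMr// ler_wpM2l.
have phi0 : phi K 0 <= 0.
  have d0 (u : 'rV[R]_n) : dotv u 0 = 0 by rewrite -(scale0r 0) dotvZr mul0r.
  rewrite /phi d0 subr0 mulr_ge0_le0// /D big1// => i _.
  apply/eqP; rewrite eq_le dotv_ge0 andbT.
  by have := (pP i 0).2 0 (Lcone i).1; rewrite subrr d0.
pose A := closed_ball_ Num.norm (0 : 'rV[R]_n) 1.
have A0 : A 0 by rewrite /A /closed_ball_ /= subrr normr0.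
have Acpt : compact A.
  apply: bounded_closed_compact; last exact: closed_closed_ball_.
  exists 1; split; first exact: num_real.
  by move=> M M1 x; rewrite /A /closed_ball_ /= sub0r normrN => /le_trans; apply; exact: ltW.
have [|z /[!inE] Az zmin] := @EVT_min_rV _ _ (phi K) A (ex_intro _ 0 A0) Acpt.
  exact: continuous_subspaceT.
exists K => //; exists z => x; rewrite -/(D z) -/(D x) -/(phi K z) -/(phi K x).
have [x1|x1] := leP `|x| 1.
  by apply: zmin; rewrite inE /A /closed_ball_ /= sub0r normrN.
(* The minimum over the ball is at most [phi K 0 <= 0], while outside it
   [phi K x >= |x| * phi K y >= 0], because [|x| ^+ 2 >= |x|]. *)
apply: (@le_trans _ _ 0); first by apply: le_trans phi0; apply: zmin; rewrite inE.
have x0 : 0 < `|x| by lra.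
pose y := `|x|^-1 *: x.
have xE : x = `|x| *: y by rewrite scalerA divff ?gt_eqF// scale1r.
have y1 : `|y| = 1 by rewrite normrZ normfV normr_id mulVf// gt_eqF.
have := DZ _ y (ltW x1); rewrite -xE => hD.
have := phi_gt0 y y1; rewrite /phi => hy.
rewrite [in dotv xs x]xE dotvZr.
apply: (@le_trans _ _ (`|x| * (K * D y - dotv xs y))); first by rewrite mulr_ge0 ?ltW.
rewrite mulrBr lerD2r (le_trans _ (ler_wpM2l K0 hD))//.
by rewrite mulrCA ler_wpM2l// ler_wpM2r// expr2 ler_peMl// ltW.
Qed.

(** * Stationarity and conclusion *)

(** No derivative is taken: the function is quadratic, so one explicit gradient step from [z] would
    decrease it unless the gradient [w = s - xs] vanishes. *)
Lemma penalized_min_stationary (R : realType) n (N : nat) (K : R)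
    (xs z : 'rV[R]_n) (p : nat -> 'rV[R]_n) : 0 <= K ->
  (forall x, K * \sum_(i < N) dotv (z - p i) (z - p i) - dotv xs z <=
    K * \sum_(i < N) dotv (x - p i) (x - p i) - dotv xs x) ->
  xs = \sum_(i < N) (2 * K) *: (z - p i).
Proof.
move=> K0 zmin; set s := \sum_(i < N) _.
have [w wE] : exists w, w = s - xs by exists (s - xs).
have wwE : dotv w w = dotv s w - dotv xs w by rewrite {1}wE dotvDl dotvNl.
apply/esym/eqP; rewrite -subr_eq0 -wE; apply/eqP/dotv_eq0.
have key (t : R) : 0 <= K * N%:R * (t ^+ 2 * dotv w w) - t * dotv w w.
  have := zmin (z - t *: w); rewrite -subr_ge0.
  set d := (X in 0 <= X); suff -> : d = K * N%:R * (t ^+ 2 * dotv w w) - t * dotv w w by [].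
  rewrite /d; have -> : \sum_(i < N) dotv (z - t *: w - p i) (z - t *: w - p i) =
    \sum_(i < N) dotv (z - p i) (z - p i) - 2 * t * dotv (\sum_(i < N) (z - p i)) w +
    N%:R * (t ^+ 2 * dotv w w).
    rewrite dotv_suml mulr_sumr -sumrB.
    have -> : N%:R * (t ^+ 2 * dotv w w) = \sum_(i < N) (t ^+ 2 * dotv w w).
      by rewrite sumr_const card_ord mulr_natl.
    rewrite -big_split; apply: eq_bigr => i _ /=.
    have -> : z - t *: w - p i = (z - p i) - t *: w by rewrite addrAC.
    by move: (z - p i) => a; rewrite !dotvE (dotvC w a); ring.
  have sE : dotv s w = 2 * K * dotv (\sum_(i < N) (z - p i)) w.
    by rewrite /s -scaler_sumr dotvZl.
  have tww : t * dotv w w = t * (dotv s w - dotv xs w) by rewrite -wwE.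
  by rewrite dotvDr dotvNr dotvZr tww sE; ring.
(* For [t = 1 / (c + 1)] one has [c * t ^+ 2 - t = - t ^+ 2]; the [+ 1] keeps [t] defined when
   [c = 0]. *)
have := key (K * N%:R + 1)^-1; set c := K * N%:R.
have c0 : 0 <= c by rewrite mulr_ge0.
set t := (c + 1)^-1; have t0 : 0 < t by rewrite invr_gt0; lra.
have ct : c * t = 1 - t by rewrite /t; field; lra.
have -> : c * (t ^+ 2 * dotv w w) - t * dotv w w = - (t ^+ 2 * dotv w w).
  by rewrite expr2 !mulrA ct; ring.
by rewrite oppr_ge0 pmulr_rle0// exprn_gt0.
Qed.

(* The index i : nat stands for i+1 in the paper, hence the weight 1/2^(i+1) *)
Theorem theorem5p3 (R : realType) (n : nat) (L : nat -> set 'rV[R]_n)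
    (Lcone : forall i, is_cone (L i))
    (Lclosed : forall i, closed (L i))
    (Lnqc : normal_qualification L)
    (xstar : 'rV[R]_n)
    (xstarN : frechet_normals 0 (\bigcap_i L i) xstar)
    (xstar_neg : forall x : 'rV[R]_n,
       (\bigcap_i L i) x -> x != 0 -> dotv xstar x < 0) :
  exists xs : nat -> 'rV[R]_n,
    (forall i, limiting_normals 0 (L i) (xs i)) /\
    series (fun i => (1 / 2 ^+ i.+1) *: xs i) @ \oo --> xstar.
Proof.
have [N xsN] := finite_bigcap_lt0 Lclosed xstar_neg.
have /choice[p pP] : forall ix : nat * 'rV[R]_n, exists u, nearest (L ix.1) ix.2 u.
  by move=> [i x]; apply: exists_nearest => //; exact: (Lcone i).1.
have [K K0 [z zmin]] :=
  penalized_min (p := fun i x => p (i, x)) Lcone (fun i x => pP (i, x)) xsN.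
(* The power of 2 cancels the weight of the series; from [N] on the zero normal is used, so the
   partial sums become constant. *)
pose c i : R := if (i < N)%N then 2 ^+ i.+1 * (2 * K) else 0.
have xsE : xstar = \sum_(i < N) (2 * K) *: (z - p (i : nat, z)).
  apply: (penalized_min_stationary (p := fun i => p (i, z)) K0) => x.
  (* Freezing the nearest points at those of [z] only increases the sum at [x] and does not change
     it at [z]. *)
  apply: le_trans (zmin x) _; rewrite lerD2r ler_wpM2l//.
  by apply: ler_sum => i _; apply: (pP (i : nat, x)).2; exact: (pP (i : nat, z)).1.
exists (fun i => c i *: (z - p (i, z))); split=> [i|].
  apply: nearest_limiting_normals => //; first exact: pP (i, z).
  by rewrite /c; case: ifP => // _; rewrite !mulr_ge0.
apply: (@cvg_near_cst _ _ xstar); exists N => // m /= Nm.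
rewrite /series /= (@big_cat_nat _ _ _ N)//= [X in _ + X]big_nat [X in _ + X]big1 ?addr0.
  rewrite xsE big_mkord; apply: eq_bigr => i _.
  by rewrite /c ltn_ord scalerA div1r mulKf ?expf_neq0.
by move=> i /andP[Ni _]; rewrite /c ltnNge Ni scale0r scaler0.
Qed.
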